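(* Let $A$ be a noetherian commutative ring and $\mathfrak{a}$ an ideal of $A$. An $A$-module $P$ is $\mathfrak{a}$-adically projective if and only if it is a direct summand of an $\mathfrak{a}$-adically free $A$-module.
   Context: An $A$-module $N$ is $\mathfrak{a}$-adically complete if the canonical homomorphism $N \to \varprojlim_i (N/\mathfrak{a}^{i+1}N)$ is bijective. An $A$-module $P$ is $\mathfrak{a}$-adically projective if: (i) $P$ is $\mathfrak{a}$-adically complete; and (ii) whenever $M$ and $N$ are $\mathfrak{a}$-adically complete $A$-modules and $\phi : M \to N$ is a surjective homomorphism, any homomorphism $\psi : P \to N$ can be lifted to a homomorphism $\tilde{\psi} : P \to M$ such that $\psi = \phi \circ \tilde{\psi}$. Let $\widehat{A} := \varprojlim_i A/\mathfrak{a}^{i+1}$. For $a \in \widehat{A}$ put $\operatorname{ord}_{\mathfrak{a}}(a) := \sup\{ i \in \mathbb{N} \mid a \in \mathfrak{a}^i\widehat{A} \}\in \mathbb{N}\cup\{\infty\}$. For a set $Z$, a function $f : Z \to \widehat{A}$ is decaying if for every $i \in \mathbb{N}$ the set $\{ z \in Z \mid \operatorname{ord}_{\mathfrak{a}}(f(z)) \leq i\}$ is finite; $\operatorname{F}_{\mathrm{dec}}(Z, \widehat{A})$ is the module (pointwise operations) of decaying functions. An $A$-module is $\mathfrak{a}$-adically free if it is isomorphic to $\operatorname{F}_{\mathrm{dec}}(Z, \widehat{A})$ for some set $Z$. *)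

(* Defs.v *)
From HB Require Import structures.
From mathcomp Require Import all_boot all_order all_algebra.
From mathcomp Require Import mathcomp_extra boolp classical_sets functions.
From mathcomp Require Import cardinality constructive_ereal.

Set Implicit Arguments.
Unset Strict Implicit.
Unset Printing Implicit Defensive.

Import Order.TTheory GRing.Theory Num.Theory.
Local Open Scope ring_scope.
Local Open Scope quotient_scope.
Local Open Scope classical_set_scope.

(* Rings are comPzRingType, so that the zero ring is allowed.  An ideal is a
   submodule of the regular module A^o: the library's idealr is restricted to
   proper ideals, whereas the unit ideal is allowed here. *)
Notation ideal A := (submodClosed A^o).

Definition noetherian (A : comPzRingType) : Prop :=
  forall I : ideal A, exists (n : nat) (g : 'I_n -> A),
    forall x : A, x \in I <-> exists c : 'I_n -> A, x = \sum_i c i * g i.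

Section IdealSmul.
Variables (A : comPzRingType) (I : {pred A}) (V : lmodType A).

Definition ideal_smul (S : {pred V}) : V -> bool := fun v =>
  `[< exists (n : nat) (c : 'I_n -> A) (s : 'I_n -> V),
        [/\ forall i, c i \in I, forall i, s i \in S &
            v = \sum_i c i *: s i] >].

Variable S : submodClosed V.

Lemma ideal_smul_submod : GRing.submod_closed (ideal_smul S).
Proof.
split=> [|k u v /asboolP[n [c [s [Ic Ss ->]]]] /asboolP[m [d [t [Id St ->]]]]].
  apply/asboolP; exists 0%N, (fun=> 0), (fun=> 0).
  by split=> [[]|[]|] //; rewrite big_ord0.
apply/asboolP; exists (n + m)%N,
  (fun i => match fintype.split i with inl j => c j | inr j => d j end),
  (fun i => match fintype.split i with inl j => k *: s j | inr j => t j end).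
split=> [i|i|]; try by case: (fintype.split i) => j //; exact: rpredZ.
rewrite big_split_ord scaler_sumr; congr (_ + _); apply: eq_bigr => j _.
  by rewrite (unsplitK (inl j)) !scalerA mulrC.
by rewrite (unsplitK (inr j)).
Qed.

HB.instance Definition _ :=
  GRing.isSubmodClosed.Build A V (ideal_smul S) ideal_smul_submod.

End IdealSmul.

Section FullSubmodule.
Variables (A : comPzRingType) (V : lmodType A).

Definition full_submod : V -> bool := fun=> true.

Lemma full_submod_closed : GRing.submod_closed full_submod.
Proof. by []. Qed.

HB.instance Definition _ :=
  GRing.isSubmodClosed.Build A V full_submod full_submod_closed.

End FullSubmodule.

Fixpoint ideal_pow (A : comPzRingType) (a : ideal A) (n : nat) : ideal A :=
  if n is m.+1 then GRing.SubmodClosed.clone A A^o (@ideal_smul A a A^o (ideal_pow a m)) _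
  else GRing.SubmodClosed.clone A A^o (@full_submod A A^o) _.

Lemma ideal_powS (A : comPzRingType) (a : ideal A) n x :
  x \in ideal_pow a n.+1 -> x \in ideal_pow a n.
Proof.
elim: n x => [//|n IH] x /asboolP[m [c [s [ac Js ->]]]].
by apply/asboolP; exists m, c, s; split=> // i; exact: IH.
Qed.

Definition pow_submod (A : comPzRingType) (a : ideal A) (V : lmodType A)
    (n : nat) : submodClosed V :=
  GRing.SubmodClosed.clone A V
    (@ideal_smul A (ideal_pow a n) V (@full_submod A V)) _.

Section QuotientModule.
Variables (A : comPzRingType) (V : lmodType A) (W : submodClosed V).

(* submodClosed, being also about semirings, does not inherit from zmodClosed *)
Definition submod_pred : V -> bool := fun v => v \in W.

Lemma submod_pred_zmod_closed : zmod_closed submod_pred.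
Proof. exact: GRing.submod_closedB (submodClosedP W). Qed.

HB.instance Definition _ :=
  GRing.isZmodClosed.Build V submod_pred submod_pred_zmod_closed.

Definition quotmod :=
  Quotient.quot (GRing.ZmodClosed.clone V submod_pred _).
HB.instance Definition _ := Choice.on quotmod.
HB.instance Definition _ := EqQuotient.on quotmod.
HB.instance Definition _ := GRing.Zmodule.on quotmod.
HB.instance Definition _ := ZmodQuotient.on quotmod.

Definition quotmod_scale (k : A) : quotmod -> quotmod :=
  lift_op1 quotmod ( *:%R k).

Lemma quotmod_eqP (u v : V) :
  (\pi_quotmod u == \pi_quotmod v) = (u - v \in W).
Proof. by rewrite -Quotient.idealrBE. Qed.

Lemma pi_quotmod_scale k (v : V) :
  \pi_quotmod (k *: v) = quotmod_scale k (\pi_quotmod v).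
Proof.
rewrite /quotmod_scale; unlock; apply/eqP.
by rewrite quotmod_eqP -scalerBr rpredZ // -quotmod_eqP reprK.
Qed.

Fact quotmod_scaleA k l x :
  quotmod_scale k (quotmod_scale l x) = quotmod_scale (k * l) x.
Proof. by elim/quotW: x => v; rewrite -!pi_quotmod_scale scalerA. Qed.

Fact quotmod_scale1 : left_id 1 quotmod_scale.
Proof. by elim/quotW => v; rewrite -pi_quotmod_scale scale1r. Qed.

Fact quotmod_scaleDr : right_distributive quotmod_scale +%R.
Proof.
move=> k; elim/quotW => u; elim/quotW => v.
by rewrite -!pi_quotmod_scale -!(raddfD \pi_quotmod) -pi_quotmod_scale scalerDr.
Qed.

Fact quotmod_scaleDl x : {morph quotmod_scale^~ x : k l / k + l}.
Proof.
move=> k l; elim/quotW: x => v.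
by rewrite -!pi_quotmod_scale -(raddfD \pi_quotmod) scalerDl.
Qed.

HB.instance Definition _ := GRing.Zmodule_isLmodule.Build A quotmod
  quotmod_scaleA quotmod_scale1 quotmod_scaleDr quotmod_scaleDl.

End QuotientModule.

(* dependent product of modules; functions.v only has the constant case *)
Section ProductModule.
Variables (A : comPzRingType) (T : Type) (V : T -> lmodType A).

Definition prodmod := forall t, V t.
HB.instance Definition _ := Choice.on prodmod.

Implicit Types f g h : prodmod.
Let add f g : prodmod := fun t => f t + g t.
Let zero : prodmod := fun=> 0.
Let opp f : prodmod := fun t => - f t.
Let scale k f : prodmod := fun t => k *: f t.

Fact prodmod_addA : associative add.
Proof. by move=> f g h; apply/functional_extensionality_dep => t; exact: addrA. Qed.
Fact prodmod_addC : commutative add.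
Proof. by move=> f g; apply/functional_extensionality_dep => t; exact: addrC. Qed.
Fact prodmod_add0 : left_id zero add.
Proof. by move=> f; apply/functional_extensionality_dep => t; exact: add0r. Qed.
Fact prodmod_addN : left_inverse zero opp add.
Proof. by move=> f; apply/functional_extensionality_dep => t; exact: addNr. Qed.

HB.instance Definition _ := GRing.isZmodule.Build prodmod
  prodmod_addA prodmod_addC prodmod_add0 prodmod_addN.

Fact prodmod_scaleA k l f : scale k (scale l f) = scale (k * l) f.
Proof. by apply/functional_extensionality_dep => t; exact: scalerA. Qed.
Fact prodmod_scale1 : left_id 1 scale.
Proof. by move=> f; apply/functional_extensionality_dep => t; exact: scale1r. Qed.
Fact prodmod_scaleDr : right_distributive scale +%R.
Proof.
by move=> k f g; apply/functional_extensionality_dep => t; exact: scalerDr.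
Qed.
Fact prodmod_scaleDl f : {morph scale^~ f : k l / k + l}.
Proof.
by move=> k l; apply/functional_extensionality_dep => t; exact: scalerDl.
Qed.

HB.instance Definition _ := GRing.Zmodule_isLmodule.Build A prodmod
  prodmod_scaleA prodmod_scale1 prodmod_scaleDr prodmod_scaleDl.

End ProductModule.

Section Completion.
Variables (A : comPzRingType) (a : ideal A) (V : lmodType A).

Definition level (i : nat) : lmodType A := quotmod (pow_submod a V i.+1).

Definition to_level (i : nat) (v : V) : level i :=
  \pi_(quotmod (pow_submod a V i.+1)) v.

(* the projection V / a^(j+1) V -> V / a^(i+1) V for i <= j (a junk function
   for i > j, where it is not used) *)
Definition level_map (i j : nat) (x : level j) : level i :=
  to_level i (repr (x : quotmod (pow_submod a V j.+1))).

Lemma pow_submodS n v : v \in pow_submod a V n.+1 -> v \in pow_submod a V n.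
Proof.
move=> /asboolP[m [c [s [ac _ ->]]]]; apply/asboolP; exists m, c, s.
by split=> // i; apply: ideal_powS.
Qed.

Lemma pow_submod_le i j v :
  (i <= j)%N -> v \in pow_submod a V j -> v \in pow_submod a V i.
Proof. by move=> /subnK <-; elim: (j - i)%N => // n IH /pow_submodS. Qed.

Lemma level_mapE i j v : (i <= j)%N ->
  level_map i (to_level j v) = to_level i v.
Proof.
move=> ij; apply/eqP; rewrite quotmod_eqP.
by apply: (@pow_submod_le i.+1 j.+1) => //; rewrite -quotmod_eqP reprK.
Qed.

Definition coherent : prodmod level -> bool := fun x =>
  `[< forall i j, (i <= j)%N -> level_map i (x j) = x i >].

Lemma level_mapP i j k (x y : level j) : (i <= j)%N ->
  level_map i (k *: x + y) = k *: level_map i x + level_map i y.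
Proof.
move=> ij; elim/quotW: x => u; elim/quotW: y => v.
have E w : to_level j w = \pi_(quotmod (pow_submod a V j.+1)) w by [].
have EP n w1 w2 :
    k *: to_level n w1 + to_level n w2 = to_level n (k *: w1 + w2).
  rewrite /to_level (raddfD \pi_(quotmod (pow_submod a V n.+1))) /=.
  by rewrite pi_quotmod_scale.
by rewrite -!E EP !level_mapE // EP.
Qed.

Lemma coherent_submod_closed : GRing.submod_closed coherent.
Proof.
split=> [|k x y /asboolP Cx /asboolP Cy]; apply/asboolP => i j ij.
  have := level_mapP (-1) (0 : level j) 0 ij.
  by rewrite scaler0 addr0 scaleN1r addNr.
by rewrite [LHS]level_mapP // Cx // Cy.
Qed.

HB.instance Definition _ :=
  GRing.isSubmodClosed.Build A (prodmod level) coherent coherent_submod_closed.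

Definition completion := {x : prodmod level | coherent x}.

HB.instance Definition _ := [isSub of completion for @sval _ _].
HB.instance Definition _ := [Choice of completion by <:].
HB.instance Definition _ := [SubChoice_isSubLmodule of completion by <:].

Fact to_completion_subproof (v : V) :
  coherent ((fun i => to_level i v) : prodmod level).
Proof. by apply/asboolP => i j; exact: level_mapE. Qed.

Definition to_completion (v : V) : completion :=
  Sub ((fun i => to_level i v) : prodmod level) (to_completion_subproof v).

Definition adically_complete : Prop := bijective to_completion.

End Completion.

Definition adically_projective (A : comPzRingType) (a : ideal A)
    (P : lmodType A) : Prop :=
  adically_complete a P /\
  forall (M N : lmodType A), adically_complete a M -> adically_complete a N ->
  forall phi : {linear M -> N}, (forall y : N, exists x : M, phi x = y) ->
  forall psi : {linear P -> N},
  exists psi' : {linear P -> M}, forall p : P, psi p = phi (psi' p).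

(* The A-module underlying the ring lim_i A / a^(i+1): since a^(i+1) A^o is the
   ideal a^(i+1), this is the completion of the regular module. *)
Definition adic_ring (A : comPzRingType) (a : ideal A) : lmodType A :=
  completion a A^o.

(* The supremum is taken in \bar int, but as 0 belongs to the set its value is
   always in N or +oo. *)
Definition adic_ord (A : comPzRingType) (a : ideal A) (x : adic_ring a) :
    \bar int :=
  supremum 0%E
    [set (i%:Z)%:E | i in [set i : nat | x \in pow_submod a (adic_ring a) i]].

Section DecayingFunctions.
Variables (A : comPzRingType) (a : ideal A) (Z : Type).

Definition decaying : (Z -> adic_ring a) -> bool := fun f =>
  `[< forall i : nat, finite_set [set z | (adic_ord (f z) <= i%:Z%:E)%O] >].

Lemma adic_ord_le (x : adic_ring a) (i : nat) :
  (adic_ord x <= i%:Z%:E)%O = (x \notin pow_submod a (adic_ring a) i.+1).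
Proof.
have Q0 : x \in pow_submod a (adic_ring a) 0.
  apply/asboolP; exists 1%N, (fun=> 1), (fun=> x).
  by split; rewrite // big_ord1 scale1r.
have supE S m : S 0%E -> supremums S m -> supremum 0%E S = m :> \bar int.
  move=> S0 Sm; rewrite /supremum ifF; last first.
    by apply/negbTE/set0P; exists 0%E.
  by case: xgetP => [y _ Sy|/(_ m)//]; exact: is_subset1_supremums Sy Sm.
rewrite /adic_ord; set S := [set _ | _ in _].
have S0 : S 0%E by exists 0%N.
have [allQ|/existsNP exQ] :=
    pselect (forall n, x \in pow_submod a (adic_ring a) n).
  rewrite (supE S +oo%E) ?allQ //; split=> [y _|y uy]; first exact: leey.
  have {}uy n : (n%:Z%:E <= y)%E by apply: uy; exists n => //; exact: allQ.
  case: y uy => [r| |] // uy; last by have := uy 0%N.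
  have := uy (absz r).+1; rewrite lee_fin => /le_trans/(_ (lez_abs r)).
  by rewrite lez_nat ltnn.
have {}exQ : exists n, x \notin pow_submod a (adic_ring a) n.
  by case: exQ => n /negP; exists n.
case: (ex_minnP exQ) => -[|n nQ minQ]; first by rewrite Q0.
have Qn : x \in pow_submod a (adic_ring a) n.
  by apply/negPn/negP => /minQ; rewrite ltnn.
have ltQ k : x \in pow_submod a (adic_ring a) k -> (k <= n)%N.
  by move=> Qk; rewrite leqNgt; apply: contra nQ => /pow_submod_le; exact.
rewrite (supE S n%:Z%:E) //; last first.
  split=> [_ [k /ltQ kn <-]|y uy]; first by rewrite lee_fin lez_nat.
  by apply: uy; exists n.
rewrite lee_fin lez_nat; apply/idP/idP => [ni|]; last by move/minQ.
by apply: contra nQ; exact: pow_submod_le.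
Qed.

Lemma decaying_submod_closed : GRing.submod_closed decaying.
Proof.
split=> [|k f g /asboolP df /asboolP dg]; apply/asboolP => i.
  rewrite (_ : [set _ | _] = set0) //; apply/seteqP; split=> // z /=.
  by rewrite adic_ord_le rpred0.
have fin : finite_set ([set z | (adic_ord (f z) <= i%:Z%:E)%O] `|`
                      [set z | (adic_ord (g z) <= i%:Z%:E)%O]).
  by rewrite finite_setU; split; [exact: df|exact: dg].
apply: sub_finite_set fin => z /=.
rewrite !adic_ord_le => h; apply/orP; rewrite -negb_and.
by apply: contra h => /andP[fz gz]; rewrite rpredD // rpredZ.
Qed.

HB.instance Definition _ := GRing.isSubmodClosed.Build A (Z -> adic_ring a)
  decaying decaying_submod_closed.

Definition Fdec := {f : Z -> adic_ring a | decaying f}.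

HB.instance Definition _ := [isSub of Fdec for @sval _ _].
HB.instance Definition _ := [Choice of Fdec by <:].
HB.instance Definition _ := [SubChoice_isSubLmodule of Fdec by <:].

End DecayingFunctions.

Definition adically_free (A : comPzRingType) (a : ideal A) (F : lmodType A) :
    Prop :=
  exists (Z : Type) (phi : {linear F -> Fdec a Z}), bijective phi.

Definition direct_summand (A : comPzRingType) (P F : lmodType A) : Prop :=
  exists (Q : lmodType A) (phi : {linear (P * Q)%type -> F}), bijective phi.

(* Main.v *)
Require Import Defs.
From HB Require Import structures.
From mathcomp Require Import all_boot all_order all_algebra.
From mathcomp Require Import boolp classical_sets cardinality.

Set Implicit Arguments.
Unset Strict Implicit.
Unset Printing Implicit Defensive.

Import GRing.Theory.
Local Open Scope ring_scope.
Local Open Scope quotient_scope.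

(** Write Â for the completion of A and F(Z) for the module of decaying
functions on Z, and let delta z in F(Z) be the indicator function of z.

The family delta is a topological basis of F(Z) (delta_basis): every f is
congruent modulo a^n F(Z) to a finite combination of the delta z, because f
takes values outside a^n Â at finitely many points only and A -> Â / a^n Â is
onto; and a finite combination lies in a^n F(Z) exactly when all its
coefficients lie in a^n.  Hence any map h from Z to a complete module M extends
to a linear map on F(Z) (linear_extension): replace f by approximating
combinations, apply h to them, and take the limit in M.  Linear maps into a
complete module are continuous, so they are determined by their values on the
basis (linear_eq_on_basis).  As F(Z) is itself complete, it is projective: to
lift psi : F(Z) -> N along a surjection M -> N, lift the elements psi (delta z)
one by one and extend.

The equivalence is then formal.  Both completeness and the lifting property
pass to retracts, in particular to direct summands of adically free modules.
Conversely, if P is adically projective then the identity map of P extends to a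
surjection F(P) -> P between complete modules; lifting the identity of P
through it splits F(P) as the sum of P and the kernel.

The place where the noetherian hypothesis enters is the identification of the
topologies of Â and of F(Z) with the a-adic ones: a^n Â is the kernel of
Â -> A / a^n, and a^n F(Z) consists of the functions with values in a^n Â.
Both, together with the completeness of Â and F(Z), are instances of one
statement about filtrations (filtration_is_adic), which rests on a^n being
finitely generated. *)

(** * Powers of an ideal *)

Section IdealProducts.
Variable A : comPzRingType.

Lemma mem_ideal_smul (I : {pred A}) (V : lmodType A) (S : {pred V}) c v :
  c \in I -> v \in S -> c *: v \in ideal_smul I S.
Proof.
move=> cI vS; apply/asboolP; exists 1%N, (fun=> c), (fun=> v).
by split; rewrite // big_ord1.
Qed.

Lemma ideal_smul_sub (I : {pred A}) (V : lmodType A) (S : {pred V})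
    (W : submodClosed V) :
  (forall c v, c \in I -> v \in S -> c *: v \in W) ->
  forall v, v \in ideal_smul I S -> v \in W.
Proof.
by move=> IS v /asboolP[n [c [s [cI sS ->]]]]; apply: rpred_sum => i _; exact: IS.
Qed.

Definition smul_submod (I : {pred A}) (V : lmodType A) (W : submodClosed V) :
    submodClosed V :=
  GRing.SubmodClosed.clone A V (ideal_smul I W) _.

Lemma ideal_smul_gens (I : {pred A}) (V : lmodType A) (W : submodClosed V)
    r (g : 'I_r -> A) :
    (forall x, x \in I -> exists c : 'I_r -> A, x = \sum_j c j * g j) ->
  forall v, v \in smul_submod I W ->
  exists2 w : 'I_r -> V, forall j, w j \in W & v = \sum_j g j *: w j.
Proof.
move=> gI v /asboolP[n [c [s [cI sW ->]]]].
have [d dE] := choice (fun i => gI _ (cI i)).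
exists (fun j => \sum_i d i j *: s i) => [j|].
  by apply: rpred_sum => i _; rewrite rpredZ.
under [RHS]eq_bigr do rewrite scaler_sumr.
rewrite exchange_big /=; apply: eq_bigr => i _.
rewrite {1}dE scaler_suml; apply: eq_bigr => j _.
by rewrite scalerA mulrC.
Qed.

Variables (a : ideal A) (V : lmodType A).
Implicit Types (v : V) (n m : nat).

Lemma pow_submod0 v : v \in pow_submod a V 0.
Proof. by rewrite -[v]scale1r; exact: mem_ideal_smul. Qed.

Lemma mem_pow_submod n c v : c \in ideal_pow a n -> c *: v \in pow_submod a V n.
Proof. by move=> cn; exact: mem_ideal_smul. Qed.

Lemma pow_submod_sub n (W : submodClosed V) :
  (forall c v, c \in ideal_pow a n -> c *: v \in W) ->
  forall v, v \in pow_submod a V n -> v \in W.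
Proof. by move=> IW; apply: ideal_smul_sub => c v cI _; exact: IW. Qed.

(** This is what lets a factor a^n be taken out of the terms of a series whose
m-th term lies in a^(n+m) V, leaving terms that still tend to zero. *)
Lemma pow_submodD n m v : v \in pow_submod a V (n + m) ->
  v \in smul_submod (ideal_pow a n) (pow_submod a V m).
Proof.
apply: pow_submod_sub => {v} c v; elim: n c => [|n IH] c.
  rewrite add0n => cm; rewrite -[_ *: _]scale1r.
  by apply: mem_ideal_smul => //; exact: mem_pow_submod.
move=> /asboolP[k [b [d [ba dn ->]]]]; rewrite scaler_suml.
apply: rpred_sum => i _; rewrite -scalerA.
have /asboolP[l [e [t [en tm ->]]]] := IH _ (dn i).
rewrite scaler_sumr; apply: rpred_sum => j _; rewrite scalerA.
apply: mem_ideal_smul => //.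
exact: (@mem_ideal_smul a A^o (ideal_pow a n)).
Qed.

End IdealProducts.

Lemma linear_pow_submod (A : comPzRingType) (a : ideal A)
    (V W : lmodType A) (f : {linear V -> W}) n v :
  v \in pow_submod a V n -> f v \in pow_submod a W n.
Proof.
move=> /asboolP[k [c [s [cn _ ->]]]]; rewrite linear_sum.
by apply: rpred_sum => i _; rewrite linearZ_LR; exact: mem_pow_submod.
Qed.

Lemma mem_pow_regular (A : comPzRingType) (a : ideal A) n (c : A) :
  (c : A^o) \in pow_submod a A^o n -> c \in ideal_pow a n.
Proof.
move=> /asboolP[k [d [s [dn _ ->]]]].
by apply: rpred_sum => i _; rewrite [_ *: _]mulrC; exact: (@rpredZ A A^o).
Qed.

Lemma ideal_pow_gens (A : comPzRingType) (a : ideal A) n : noetherian A ->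
  exists (r : nat) (g : 'I_r -> A), (forall j, g j \in ideal_pow a n) /\
    forall x, x \in ideal_pow a n -> exists c : 'I_r -> A, x = \sum_j c j * g j.
Proof.
move=> /(_ (ideal_pow a n))[r [g gP]]; exists r, g; split=> [j|x /gP//].
apply/gP; exists (fun i => (i == j)%:R).
rewrite (bigD1 j) //= eqxx mul1r big1 ?addr0 // => i /negbTE ->.
by rewrite mul0r.
Qed.

(** * Complete filtrations *)

Section Filtrations.
Variables (A : comPzRingType) (M : lmodType A).
Implicit Type K : nat -> set M.

Definition separated K := forall x, (forall n, K n x) -> x = 0.

Definition cauchy_convergent K := forall u : nat -> M,
  (forall n, K n (u n.+1 - u n)) -> exists x, forall n, K n (x - u n).

(** Completeness without the inverse limit: a coherent family of residue classes
is the same as a sequence with u (n+1) = u n modulo a^n M, up to choosing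
representatives. *)
Lemma completeP (a : ideal A) : adically_complete a M <->
  separated (fun n => [set` pow_submod a M n]%classic) /\
  cauchy_convergent (fun n => [set` pow_submod a M n]%classic).
Proof.
have levelE n x y :
  (to_level a n x == to_level a n y) = (x - y \in pow_submod a M n.+1).
  exact: quotmod_eqP.
split=> [[inv toK invK]|[sepM limM]].
  split=> [x xK|u uK].
    apply: (can_inj toK); apply/val_inj/functional_extensionality_dep => n /=.
    by apply/eqP; rewrite levelE subr0; exact: xK.
  have uK' i j : (i <= j)%N -> u j - u i \in pow_submod a M i.
    move=> /subnKC <-; elim: (j - i)%N => [|k IH].
      by rewrite addn0 subrr rpred0.
    rewrite addnS -(subrKA (u (i + k)%N)) rpredD //.
    by apply: (@pow_submod_le _ _ _ _ (i + k)); rewrite ?leq_addr //; exact: uK.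
  have cu : coherent ((fun i => to_level a i (u i.+1)) : prodmod (level a M)).
    apply/asboolP => i j ij; rewrite level_mapE //; apply/eqP.
    by rewrite levelE; exact: uK'.
  exists (inv (Sub _ cu)) => -[|n]; first exact: pow_submod0.
  have /(congr1 val)/(congr1 (fun f => f n)) /= := invK (Sub _ cu).
  by move=> /eqP; rewrite levelE.
have injM : injective (to_completion a (V := M)).
  move=> x y /(congr1 val) xy; apply/eqP; rewrite -subr_eq0; apply/eqP.
  apply: sepM => -[|n]; first exact: pow_submod0.
  by rewrite /= -levelE; move: xy => /(congr1 (fun f => f n)) /= ->.
have surM (x : completion a M) : exists y, to_completion a y = x.
  have /asboolP xcoh := valP x.
  pose u n : M := repr (val x n : quotmod (pow_submod a M n.+1)).
  have uE n : to_level a n (u n) = val x n by exact: reprK.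
  have uK n : u n.+1 - u n \in pow_submod a M n.+1.
    by rewrite -levelE uE -(xcoh n n.+1 (leqnSn n)).
  have [y yu] := limM u (fun n => pow_submodS (uK n)).
  exists y; apply/val_inj/functional_extensionality_dep => n /=.
  rewrite -[RHS]uE; apply/eqP; rewrite levelE -(subrKA (u n.+1)) rpredD //.
  exact: yu.
have [inv invK] := choice surM.
by exists inv => // x; apply: injM; rewrite invK.
Qed.

Variables (a : ideal A) (K : nat -> set M).
Hypothesis hA : noetherian A.
Hypothesis K_linear : forall n k x y, K n x -> K n y -> K n (k *: x + y).
Hypothesis K_decr : forall n x, K n.+1 x -> K n x.
Hypothesis pow_sub_K : forall n x, x \in pow_submod a M n -> K n x.
Hypothesis K_step : forall n x, K n x ->
  exists2 y, y \in pow_submod a M n & K n.+1 (x - y).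
Hypotheses (K_sep : separated K) (K_cvg : cauchy_convergent K).

(** Let x be in K n.  Peeling off one adic term after the other by K_step writes
x as a series of terms y_m in a^(n+m) M.  If g_1, ..., g_r generate a^n then
y_m is the sum over j of g_j e_mj with e_mj in a^m M, so for each j the series
of the e_mj converges to some f_j, and x is the sum of the g_j f_j, which is in
a^n M. *)
Lemma filtration_is_adic n x : K n x <-> x \in pow_submod a M n.
Proof.
split=> [Kx|]; last exact: pow_sub_K.
have K0 m : K m 0 by apply: pow_sub_K; exact: rpred0.
have KB m u v : K m u -> K m v -> K m (u - v).
  by move=> Ku Kv; rewrite addrC -scaleN1r; exact: K_linear.
have Ksum m r (g : 'I_r -> A) (F : 'I_r -> M) :
    (forall j, K m (F j)) -> K m (\sum_j g j *: F j).
  by move=> KF; elim/big_rec: _ => // j u _ Ku; exact: K_linear.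
have K_le k m u : (k <= m)%N -> K m u -> K k u.
  by move=> /subnK <-; elim: (m - k)%N => // i IH /K_decr.
have /choice[y yP] : forall m, exists f : M -> M, forall u, K m u ->
    f u \in pow_submod a M m /\ K m.+1 (u - f u).
  move=> m; suff /choice[f fP] : forall u, exists v, K m u ->
    v \in pow_submod a M m /\ K m.+1 (u - v) by exists f.
  move=> u; have [/K_step[v]|nKu] := pselect (K m u); last by exists 0.
  by exists v.
(* rem m is what remains of x once y_0, ..., y_(m-1) have been removed *)
pose rem := fix rem m := if m is m'.+1 then rem m' - y (n + m')%N (rem m') else x.
have remK m : K (n + m)%N (rem m).
  elim: m => [|m IH]; first by rewrite addn0.
  by rewrite addnS; exact: (yP _ _ IH).2.
have [r [g [gn gP]]] := ideal_pow_gens a n hA.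
have /choice[e eP] : forall m, exists f : 'I_r -> M,
    (forall j, f j \in pow_submod a M m) /\
    y (n + m)%N (rem m) = \sum_j g j *: f j.
  move=> m; have /pow_submodD/(ideal_smul_gens gP)[w wm ->] := (yP _ _ (remK m)).1.
  by exists w.
have /choice[f fP] : forall j, exists v,
    forall m, K m (v - \sum_(i < m) e i j).
  move=> j; apply: K_cvg => m; rewrite big_ord_recr /= addrC addrK.
  exact/pow_sub_K/(eP m).1.
have xE m : x = rem m + \sum_j g j *: \sum_(i < m) e i j.
  elim: m => [|m IH].
    by rewrite big1 ?addr0 // => j _; rewrite big_ord0 scaler0.
  under eq_bigr do rewrite big_ord_recr /= scalerDr.
  by rewrite big_split /= -(eP m).2 addrCA subrK addrC.
have -> : x = \sum_j g j *: f j.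
  apply/eqP; rewrite -subr_eq0; apply/eqP/K_sep => m.
  rewrite (xE m) -addrA -sumrB; under eq_bigr do rewrite -scalerBr -opprB scalerN.
  rewrite sumrN; apply: KB; last exact: Ksum.
  by apply: K_le (remK m); rewrite leq_addl.
by apply: rpred_sum => j _; exact: mem_pow_submod.
Qed.

Lemma filtration_complete : adically_complete a M.
Proof.
have E : (fun n => [set` pow_submod a M n]%classic) = K.
  apply: functional_extensionality_dep => n; apply/seteqP.
  by split=> x /filtration_is_adic.
by apply/completeP; rewrite E.
Qed.

End Filtrations.

(** * Completions are complete *)

Section Completions.
Variables (A : comPzRingType) (hA : noetherian A) (a : ideal A) (V : lmodType A).

(** For n > 0 this is the kernel of the projection to V / a^n V, by coherence. *)
Let K n : set (completion a V) :=
  [set x | forall i, (i < n)%N -> val x i = 0]%classic.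

Let to_levelE n (v : V) : (to_level a n v == 0) = (v \in pow_submod a V n.+1).
Proof.
have -> : (0 : level a V n) = to_level a n 0.
  by rewrite /to_level (raddf0 \pi_(quotmod (pow_submod a V n.+1))).
by rewrite /to_level quotmod_eqP subr0.
Qed.

Lemma completion_level (x : completion a V) n :
  exists v : V, forall i, (i <= n)%N -> val x i = to_level a i v.
Proof.
have /asboolP xcoh := valP x.
pose v : V := repr (val x n : quotmod (pow_submod a V n.+1)).
exists v => i le_in; rewrite -(xcoh i n le_in).
have <- : to_level a n v = val x n; first exact: reprK.
exact: level_mapE.
Qed.

Fact to_completion_is_linear : linear (to_completion a (V := V)).
Proof.
move=> k u v; apply/val_inj/functional_extensionality_dep => n /=.
rewrite /to_level (raddfD \pi_(quotmod (pow_submod a V n.+1))) /=.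
by rewrite pi_quotmod_scale.
Qed.
HB.instance Definition _ := GRing.isLinear.Build A V (completion a V) _
  (to_completion a (V := V)) to_completion_is_linear.

Let K_linear n k x y : K n x -> K n y -> K n (k *: x + y).
Proof.
move=> Kx Ky i lt_in; rewrite -[LHS]/(k *: val x i + val y i).
by rewrite Kx // Ky // scaler0 addr0.
Qed.

Let K_decr n x : K n.+1 x -> K n x.
Proof. by move=> Kx i lt_in; apply: Kx; exact: ltnW. Qed.

Let pow_sub_K n x : x \in pow_submod a (completion a V) n -> K n x.
Proof.
move=> /asboolP[m [c [s [cn _ ->]]]]; elim/big_ind: _ => [i|u v Ku Kv|j _ i] //.
  by rewrite -[u]scale1r; exact: K_linear.
move=> lt_in; have [v vP] := completion_level (s j) i.
rewrite -[LHS]/(c j *: val (s j) i) vP //.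
transitivity (to_level a i (c j *: v)); first by rewrite /to_level pi_quotmod_scale.
apply/eqP; rewrite to_levelE; apply: pow_submod_le lt_in _.
exact: mem_pow_submod.
Qed.

(** A representative v of the component of x in V / a^(n+1) V is itself in a^n V
when x is in K n. *)
Let K_step n x : K n x ->
  exists2 y, y \in pow_submod a (completion a V) n & K n.+1 (x - y).
Proof.
move=> Kx; have [v vP] := completion_level x n; exists (to_completion a v).
  apply: linear_pow_submod; case: n Kx vP => [|n] Kx vP; first exact: pow_submod0.
  by rewrite -to_levelE -vP // Kx.
by move=> i lt_in; rewrite -[LHS]/(val x i - to_level a i v) vP ?subrr.
Qed.

Let K_sep : separated K.
Proof.
move=> x Kx; apply/val_inj/functional_extensionality_dep => i.
exact: (Kx i.+1).
Qed.

(** The component at i of the sequence is constant from the index i+1 on. *)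
Let K_cvg : cauchy_convergent K.
Proof.
move=> u uK.
have uE i j : (i < j)%N -> val (u j) i = val (u i.+1) i.
  move=> /subnKC <-; elim: (j - i.+1)%N => [|k IH]; first by rewrite addn0.
  rewrite -IH addnS; apply/eqP; rewrite -subr_eq0; apply/eqP.
  by apply: (uK (i.+1 + k)%N); rewrite leq_addr.
have xcoh : coherent ((fun i => val (u i.+1) i) : prodmod (level a V)).
  apply/asboolP => i j le_ij; have /asboolP ucoh := valP (u j.+1).
  by rewrite ucoh // uE.
exists (Sub _ xcoh) => n i lt_in.
by rewrite -[LHS]/(val (u i.+1) i - val (u n) i) uE // subrr.
Qed.

Lemma completion_powE n x : K n x <-> x \in pow_submod a (completion a V) n.
Proof. exact: (filtration_is_adic hA K_linear). Qed.

Lemma completion_complete : adically_complete a (completion a V).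
Proof. exact: (filtration_complete hA K_linear). Qed.

Lemma completion_approx (x : completion a V) n :
  exists v : V, x - to_completion a v \in pow_submod a (completion a V) n.
Proof.
have [v vP] := completion_level x n; exists v; apply/completion_powE => i lt_in.
by rewrite /= -[LHS]/(val x i - to_level a i v) vP ?subrr // ltnW.
Qed.

Lemma to_completion_pow n (v : V) :
  to_completion a v \in pow_submod a (completion a V) n ->
  v \in pow_submod a V n.
Proof.
case: n => [|n] /completion_powE Kv; first exact: pow_submod0.
by rewrite -to_levelE; apply/eqP/(Kv n).
Qed.

End Completions.

(** * Modules of decaying functions *)

Section DecayingFunctions.
Variables (A : comPzRingType) (hA : noetherian A) (a : ideal A) (Z : Type).
Implicit Types (f : Fdec a Z).

Definition coordinate (z : Z) f : adic_ring a := val f z.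

Fact coordinate_is_linear z : linear (coordinate z).
Proof. by []. Qed.
HB.instance Definition _ z := GRing.isLinear.Build A (Fdec a Z) (adic_ring a) _
  (coordinate z) (coordinate_is_linear z).

Lemma decayingP (f : Z -> adic_ring a) : decaying f <->
  forall n, finite_set [set z | f z \notin pow_submod a (adic_ring a) n]%classic.
Proof.
split=> [/asboolP df [|n]|df].
- rewrite (_ : [set _ | _]%classic = set0) //; apply/seteqP; split=> // z /=.
  by rewrite pow_submod0.
- by under eq_set do rewrite -adic_ord_le; exact: df.
- by apply/asboolP => n; under eq_set do rewrite adic_ord_le; exact: df.
Qed.

Let K n : set (Fdec a Z) :=
  [set f | forall z, coordinate z f \in pow_submod a (adic_ring a) n]%classic.

Let K_linear n k f g : K n f -> K n g -> K n (k *: f + g).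
Proof.
move=> Kf Kg z.
rewrite -[coordinate z _]/(k *: coordinate z f + coordinate z g).
by rewrite rpredD // rpredZ.
Qed.

Let K_decr n f : K n.+1 f -> K n f.
Proof. by move=> Kf z; apply: pow_submodS. Qed.

Let pow_sub_K n f : f \in pow_submod a (Fdec a Z) n -> K n f.
Proof. by move=> fn z; exact: linear_pow_submod. Qed.

(** Modulo a^(n+1) Â the values of f are images of elements of a^n, that is of
combinations of generators g_j of a^n; the coefficients of each g_j, set to zero
where f is already in a^(n+1) Â, form a decaying function. *)
Let K_step n f : K n f ->
  exists2 g, g \in pow_submod a (Fdec a Z) n & K n.+1 (f - g).
Proof.
move=> Kf; have [r [g [gn gP]]] := ideal_pow_gens a n hA.
have /choice[d dP] : forall z, exists d : 'I_r -> A,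
    (coordinate z f \in pow_submod a (adic_ring a) n.+1 -> d = fun=> 0) /\
    coordinate z f - to_completion a (\sum_j d j * g j : A^o)
      \in pow_submod a (adic_ring a) n.+1.
  move=> z; have [fz|fz] :=
    boolP (coordinate z f \in pow_submod a (adic_ring a) n.+1).
    exists (fun=> 0); split=> //; rewrite big1 ?linear0 ?addr0 // => j _.
    by rewrite mul0r.
  have [v vP] := completion_approx hA (coordinate z f) n.+1.
  have /gP[d vE] : (v : A) \in ideal_pow a n.
    apply/mem_pow_regular/(to_completion_pow hA).
    rewrite -[to_completion a v](subKr (coordinate z f)) rpredB //.
    exact: pow_submodS.
  by exists d; split; rewrite -?vE.
have sdec j : decaying (fun z => to_completion a (d z j : A^o)).
  apply/decayingP => m; have /decayingP/(_ n.+1) := valP f.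
  apply: sub_finite_set => z /=; apply: contra => /(dP z).1 ->.
  by rewrite linear0 rpred0.
exists (\sum_j g j *: (Sub _ (sdec j) : Fdec a Z)).
  by apply: rpred_sum => j _; exact: mem_pow_submod.
move=> z; rewrite linearB linear_sum.
set rhs := \sum_j _; suff <- : to_completion a (\sum_j d z j * g j : A^o) = rhs.
  exact: (dP z).2.
rewrite (linear_sum (to_completion a (V := A^o))); apply: eq_bigr => j _.
rewrite -[RHS]/(g j *: to_completion a (d z j : A^o)).
rewrite -[RHS](linearZ_LR (to_completion a (V := A^o))).
exact: (congr1 (to_completion a (V := A^o)) (mulrC _ _)).
Qed.

Let K_sep : separated K.
Proof.
have [+ _] := (completeP (adic_ring a) a).1 (completion_complete hA a A^o).
move=> sepA f Kf; apply/val_inj/functional_extensionality_dep => z.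
by apply: sepA => n; exact: Kf.
Qed.

Let K_cvg : cauchy_convergent K.
Proof.
have [_] := (completeP (adic_ring a) a).1 (completion_complete hA a A^o).
move=> limA u uK.
have /choice[f fP] : forall z, exists x, forall n,
    x - coordinate z (u n) \in pow_submod a (adic_ring a) n.
  by move=> z; apply: limA => n; rewrite /= -linearB; exact: uK.
have fdec : decaying f.
  apply/decayingP => n; have /decayingP/(_ n) := valP (u n).
  apply: sub_finite_set => z /=; apply: contra => uz.
  by rewrite -(subrK (coordinate z (u n)) (f z)) rpredD.
by exists (Sub _ fdec) => n z; rewrite linearB; exact: fP.
Qed.

Lemma Fdec_powE n f : (forall z, val f z \in pow_submod a (adic_ring a) n) <->
  f \in pow_submod a (Fdec a Z) n.
Proof. exact: (filtration_is_adic hA K_linear). Qed.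

Lemma Fdec_complete : adically_complete a (Fdec a Z).
Proof. exact: (filtration_complete hA K_linear). Qed.

End DecayingFunctions.

(** * Topological bases *)

Lemma sum_uniq_pred1 (V : nmodType) (T : eqType) (s : seq T) x (F : T -> V) :
  uniq s -> x \in s -> \sum_(y <- s | y == x) F y = F x.
Proof. by move=> us xs; rewrite -big_filter filter_pred1_uniq // big_seq1. Qed.

Section TopologicalBases.
Variables (A : comPzRingType) (a : ideal A) (Z : choiceType).

(** Finite combinations are kept as lists of pairs, possibly with repeated
points, so that adding them is concatenation; coef gathers the repetitions. *)
Definition comb (M : lmodType A) (h : Z -> M) (l : seq (A * Z)) : M :=
  \sum_(p <- l) p.1 *: h p.2.

Definition coef (l : seq (A * Z)) (z : Z) : A := \sum_(p <- l | p.2 == z) p.1.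

Definition scale_comb k (l : seq (A * Z)) := [seq (k * p.1, p.2) | p <- l].

Lemma comb_scale (M : lmodType A) (h : Z -> M) k l :
  comb h (scale_comb k l) = k *: comb h l.
Proof.
by rewrite /comb big_map scaler_sumr; under [RHS]eq_bigr do rewrite scalerA.
Qed.

Lemma comb_cat (M : lmodType A) (h : Z -> M) l1 l2 :
  comb h (l1 ++ l2) = comb h l1 + comb h l2.
Proof. exact: big_cat. Qed.

Lemma linear_comb (M N : lmodType A) (phi : {linear M -> N}) h l :
  phi (comb h l) = comb (phi \o h) l.
Proof. by rewrite linear_sum; apply: eq_bigr => p _; rewrite linearZ_LR. Qed.

Lemma comb_coef (M : lmodType A) (h : Z -> M) l :
  comb h l = \sum_(z <- undup (map snd l)) coef l z *: h z.
Proof.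
under eq_bigr do rewrite scaler_suml.
rewrite (exchange_big_dep xpredT) //= [LHS]big_seq [RHS]big_seq.
apply: eq_bigr => p pl; under eq_bigl do rewrite eq_sym.
by rewrite sum_uniq_pred1 ?undup_uniq // mem_undup map_f.
Qed.

(** The second condition is linear independence modulo each a^n. *)
Definition topological_basis (F : lmodType A) (b : Z -> F) : Prop :=
  (forall f n, exists l, f - comb b l \in pow_submod a F n) /\
  (forall n l, comb b l \in pow_submod a F n ->
     forall z, coef l z \in ideal_pow a n).

Variables (F : lmodType A) (b : Z -> F).
Hypothesis b_basis : topological_basis b.

(** Up to a^n M, the value of a combination under any h depends only on the class
of the combination modulo a^n F: this is the well-definedness behind the
extension of h. *)
Lemma comb_pow (M : lmodType A) (h : Z -> M) n l :
  comb b l \in pow_submod a F n -> comb h l \in pow_submod a M n.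
Proof.
move=> /(b_basis.2 n l) ln; rewrite comb_coef.
by apply: rpred_sum => z _; exact: mem_pow_submod.
Qed.

(** L f m says that m is the limit of comb h l when comb b l tends to f.  This
relation is linear, and it is a function because comb_pow makes the images
of approximations of f a Cauchy sequence, whose limit is 0 when f is 0. *)
Lemma linear_extension (M : lmodType A) (h : Z -> M) : adically_complete a M ->
  exists phi : {linear F -> M}, forall z, phi (b z) = h z.
Proof.
move=> /completeP[sepM limM].
pose L f m := forall n, exists l,
  f - comb b l \in pow_submod a F n /\ m - comb h l \in pow_submod a M n.
have L_linear k f1 m1 f2 m2 : L f1 m1 -> L f2 m2 ->
    L (k *: f1 + f2) (k *: m1 + m2).
  move=> L1 L2 n; have [l1 [b1 h1]] := L1 n; have [l2 [b2 h2]] := L2 n.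
  exists (scale_comb k l1 ++ l2); rewrite !comb_cat !comb_scale !opprD.
  by split; rewrite addrACA -scalerBr rpredD // rpredZ.
have L0 m : L 0 m -> m = 0.
  move=> Lm; apply: sepM => n /=; have [l [bl hl]] := Lm n.
  rewrite -(subrK (comb h l) m) rpredD //; apply: comb_pow.
  by rewrite -rpredN -sub0r.
have L_total f : exists m, L f m.
  have /choice[l lP] := b_basis.1 f.
  have [m mP] : exists m, forall n, m - comb h (l n) \in pow_submod a M n.
    apply: limM => n /=; rewrite -scaleN1r -comb_scale -comb_cat.
    apply: comb_pow; rewrite comb_cat comb_scale scaleN1r.
    rewrite -(subrKA f) addrC -opprB rpredB //; exact: pow_submodS.
  by exists m => n; exists (l n).
have [phi phiP] := choice L_total.
have L_unique f m1 m2 : L f m1 -> L f m2 -> m1 = m2.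
  move=> L1 L2; apply/eqP; rewrite -subr_eq0 addrC -scaleN1r; apply/eqP/L0.
  by rewrite -[0](addNr f) -scaleN1r; exact: L_linear.
have phi_linear : linear phi.
  by move=> k f g; apply: L_unique (phiP _) _; exact: L_linear.
pose Phi : {linear F -> M} :=
  HB.pack phi (GRing.isLinear.Build A F M _ phi phi_linear).
exists Phi => z; apply: L_unique (phiP _) _ => n; exists [:: (1, z)].
by rewrite /comb !big_seq1 !scale1r !subrr !rpred0.
Qed.

Lemma linear_eq_on_basis (N : lmodType A) (phi psi : {linear F -> N}) :
  adically_complete a N -> (forall z, phi (b z) = psi (b z)) -> phi =1 psi.
Proof.
move=> /completeP[sepN _] eq_b f; apply/eqP; rewrite -subr_eq0; apply/eqP/sepN.
move=> n /=; have [l lP] := b_basis.1 f n.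
rewrite -(subrKA (phi (comb b l))) -linearB rpredD ?linear_pow_submod //.
have -> : phi (comb b l) = psi (comb b l).
  by rewrite !linear_comb; apply: eq_bigr => p _ /=; rewrite eq_b.
by rewrite -linearB linear_pow_submod // -rpredN opprB.
Qed.

Lemma topological_basis_projective : adically_complete a F ->
  adically_projective a F.
Proof.
move=> cF; split=> // M N cM cN phi /choice[s sK] psi.
have [psi' psi'b] := linear_extension (s \o psi \o b) cM.
exists psi' => f.
apply: (linear_eq_on_basis (psi := phi \o psi')) => // z /=.
by rewrite psi'b /= sK.
Qed.

End TopologicalBases.

(** * Decaying functions are projective *)

Section FdecBasis.
Variables (A : comPzRingType) (hA : noetherian A) (a : ideal A) (Z : choiceType).

Fact delta_decaying (z : Z) :
  decaying (fun w => if w == z then to_completion a (1 : A^o) else 0).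
Proof.
apply/decayingP => n; apply: (sub_finite_set _ (finite_set1 z)) => w /=.
by case: eqP => // _; rewrite rpred0.
Qed.

Definition delta (z : Z) : Fdec a Z := Sub _ (delta_decaying z).

Lemma coordinate_comb_delta l w :
  coordinate w (comb delta l) = to_completion a (coef l w : A^o).
Proof.
rewrite linear_comb /comb /coef (linear_sum (to_completion a (V := A^o))).
rewrite [RHS]big_mkcond; apply: eq_bigr => p _ /=.
rewrite -[coordinate w _]/(if w == p.2 then to_completion a (1 : A^o) else 0).
rewrite eq_sym; case: eqP => _; last exact: scaler0.
rewrite -[LHS](linearZ_LR (to_completion a (V := A^o))).
exact: (congr1 (to_completion a (V := A^o)) (mulr1 _)).
Qed.

Lemma delta_basis : topological_basis a delta.
Proof.
split=> [f n|n l /(Fdec_powE hA) ln z]; last first.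
  apply/mem_pow_regular/(to_completion_pow hA).
  by rewrite -coordinate_comb_delta; exact: ln.
have /decayingP/(_ n)/finite_seqP[s0 s0E] := valP f.
pose s := undup s0.
have sE z : z \notin s -> coordinate z f \in pow_submod a (adic_ring a) n.
  move=> zs; apply/negPn/negP => fz; move/negP: zs; apply.
  rewrite mem_undup; have : [set` s0]%classic z by rewrite -s0E.
  by [].
have /choice[c cP] := fun z => completion_approx hA (coordinate z f) n.
exists [seq (c z : A, z) | z <- s]; apply/(Fdec_powE hA) => z.
rewrite -[val _ z]/(coordinate z _) linearB.
rewrite -[X in _ - X]/(coordinate z (comb delta _)) coordinate_comb_delta.
rewrite /coef big_map /=; have [zs|zs] := boolP (z \in s).
  by rewrite sum_uniq_pred1 ?undup_uniq //; exact: cP.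
rewrite big1_seq ?linear0 ?addr0 => [|w /andP[/eqP -> ws]]; first exact: sE.
by rewrite ws in zs.
Qed.

Lemma Fdec_projective : adically_projective a (Fdec a Z).
Proof. exact: topological_basis_projective delta_basis (Fdec_complete hA a Z). Qed.

End FdecBasis.

(** * Retracts and direct summands *)

Section Retracts.
Variables (A : comPzRingType) (a : ideal A) (P F : lmodType A).
Variables (i : {linear P -> F}) (r : {linear F -> P}).
Hypothesis iK : cancel i r.

Lemma retract_complete : adically_complete a F -> adically_complete a P.
Proof.
move=> /completeP[sepF limF]; apply/completeP; split=> [x xn|u un].
  apply: (can_inj iK); rewrite linear0; apply: sepF => n.
  exact/linear_pow_submod/xn.
have [n|y yP] := limF (i \o u).
  by rewrite /= -linearB; exact/linear_pow_submod/un.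
by exists (r y) => n; rewrite /= -(iK (u n)) -linearB; exact/linear_pow_submod/yP.
Qed.

Lemma retract_projective : adically_projective a F -> adically_projective a P.
Proof.
move=> [cF liftF]; split=> [|M N cM cN phi phi_surj psi].
  exact: retract_complete.
have [psi' psi'P] := liftF M N cM cN phi phi_surj (psi \o r).
by exists (psi' \o i) => p; rewrite /= -psi'P /= iK.
Qed.

End Retracts.

Section Kernels.
Variables (A : comPzRingType) (U V : lmodType A) (f : {linear U -> V}).

Definition in_kernel : U -> bool := fun u => f u == 0.

Fact in_kernel_closed : GRing.submod_closed in_kernel.
Proof.
split=> [|k u v]; rewrite !unfold_in /in_kernel ?linear0 // => /eqP fu /eqP fv.
by rewrite linearP fu fv scaler0 addr0.
Qed.

HB.instance Definition _ :=
  GRing.isSubmodClosed.Build A U in_kernel in_kernel_closed.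

Definition kernel := {u : U | in_kernel u}.

HB.instance Definition _ := [isSub of kernel for @sval _ _].
HB.instance Definition _ := [Choice of kernel by <:].
HB.instance Definition _ := [SubChoice_isSubLmodule of kernel by <:].

Lemma split_surjection_summand (s : {linear V -> U}) : cancel s f ->
  direct_summand V U.
Proof.
move=> sK; exists kernel.
pose g (x : V * kernel) := s x.1 + val x.2.
have g_linear : linear g.
  move=> k x y.
  rewrite -[g _]/(s (k *: x.1 + y.1) + (k *: val x.2 + val y.2)).
  by rewrite linearP /= addrACA -scalerDr.
pose G : {linear (V * kernel)%type -> U} :=
  HB.pack g (GRing.isLinear.Build A (V * kernel)%type U _ g g_linear).
have kerP u : in_kernel (u - s (f u)).
  by rewrite /in_kernel linearB sK subrr.
exists G; exists (fun u => (f u, Sub _ (kerP u))) => [[v w]|u]; last first.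
  by rewrite /= /g /= addrC subrK.
have fw : f (val w) = 0 by apply/eqP/(valP w).
have fg : f (g (v, w)) = v by rewrite /g linearD sK fw addr0.
by congr (_, _) => //; apply: val_inj; rewrite /= fg /g /= addrC addKr.
Qed.

End Kernels.

Lemma direct_summand_retract (A : comPzRingType) (P F : lmodType A) :
  direct_summand P F -> exists (i : {linear P -> F}) (r : {linear F -> P}),
    cancel i r.
Proof.
move=> [Q [phi [inv phiK invK]]].
have i_linear : linear (fun p => phi (p, 0)).
  move=> k x y; rewrite -linearP; congr (phi _).
  by rewrite -[RHS]/(k *: x + y, k *: 0 + 0) scaler0 addr0.
have r_linear : linear (fun f => (inv f).1).
  by move=> k x y; rewrite (can2_linear phiK invK).
exists (HB.pack (fun p => phi (p, 0))
  (GRing.isLinear.Build A P F _ _ i_linear) : {linear P -> F}).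
exists (HB.pack (fun f => (inv f).1)
  (GRing.isLinear.Build A F P _ _ r_linear) : {linear F -> P}).
by move=> p /=; rewrite phiK.
Qed.

Theorem corollary3p18 (A : comPzRingType) (hA : noetherian A) (a : ideal A)
    (P : lmodType A) :
  adically_projective a P <->
  exists2 F : lmodType A, adically_free a F & direct_summand P F.
Proof.
split=> [[cP liftP]|[F [Z [phi [inv phiK invK]]]]].
  have [pi piE] := linear_extension (delta_basis hA a P) id cP.
  have pi_surj p : exists f, pi f = p by exists (delta a p).
  have [s sE] := liftP _ _ (Fdec_complete hA a P) cP pi pi_surj idfun.
  exists (Fdec a P); first by exists P, idfun; exists id.
  by apply: (split_surjection_summand (f := pi) (s := s)) => p; rewrite -sE.
move=> /direct_summand_retract[i [r iK]].
apply: (retract_projective iK).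
have inv_linear : linear inv by exact: can2_linear phiK invK.
pose Inv : {linear Fdec a Z -> F} :=
  HB.pack inv (GRing.isLinear.Build A _ F _ _ inv_linear).
apply: (@retract_projective _ _ _ _ phi Inv phiK).
(* The basis delta needs a boolean equality on its index type, which the
   classical copy of Z has; F(Z) itself does not depend on it. *)
exact: (Fdec_projective hA a {classic Z}).
Qed.
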